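(* Let $(X,G)$ be a topologically transitive topological dynamical system. If $X$ admits a $G$-invariant Borel probability measure of full support, then either $(X,G)$ is minimal and equicontinuous, or $(X,G)$ has sensitive dependence on initial conditions.
   Context: A topological dynamical system $(X,G)$ is a continuous action $G\times X\to X$, $(g,x)\mapsto g.x$, of a topological group $G$ on a compact metric space $(X,d)$ (the topology of $G$ plays no role; one may take $G$ discrete). $(X,G)$ is topologically transitive if for all nonempty open $U,V\subseteq X$ there is $g\in G$ with $U\cap g.V\neq\emptyset$. It is minimal if every point has dense $G$-orbit. It is equicontinuous if the family of maps $\{x\mapsto g.x : g\in G\}$ is (uniformly) equicontinuous. $(X,G)$ has sensitive dependence on initial conditions if there is $\varepsilon>0$ such that for every $x\in X$ and every open neighborhood $U$ of $x$ there exist $y\in U$ and $g\in G$ with $d(g.x,g.y)>\varepsilon$. A Borel probability measure $\mu$ on $X$ is invariant if $\mu(A)=\mu(g^{-1}.A)$ for all Borel $A$ and all $g\in G$; it has full support if every nonempty open set has positive measure. *)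

(* Defs.v *)
From HB Require Import structures.
From mathcomp Require Import all_boot all_order all_algebra.
From mathcomp Require Import all_classical all_reals all_analysis.

Set Implicit Arguments.
Unset Strict Implicit.
Unset Printing Implicit Defensive.

Import Order.TTheory GRing.Theory Num.Theory.
Import numFieldNormedType.Exports.

Local Open Scope classical_set_scope.
Local Open Scope ring_scope.

(* Hausdorffness is not required of a topological group. *)
HB.mixin Record isTopologicalGroup G & Topological G & Group G := {
  mulg_continuous : continuous (fun p : G * G => (p.1 * p.2)%g) ;
  invg_continuous : continuous (fun g : G => (g^-1)%g)
}.

#[short(type="topologicalGroupType")]
HB.structure Definition TopologicalGroup :=
  {G of Topological G & Group G & isTopologicalGroup G}.

(* The base point only records nonemptiness: it is needed because the library's
   measurable types are pointed, and a space that carries a probability measure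
   is nonempty anyway. *)
#[short(type="pmetricType")]
HB.structure Definition PointedMetric (K : numDomainType) :=
  {M of Pointed M & Metric K M}.

Record continuous_action (G : topologicalGroupType) (X : topologicalType)
    (act : G -> X -> X) : Prop := ContinuousAction {
  act_one : forall x, act 1%g x = x ;
  act_mul : forall g h x, act (g * h)%g x = act g (act h x) ;
  act_continuous : continuous (fun p : G * X => act p.1 p.2)
}.

Definition topologically_transitive (G : topologicalGroupType)
    (X : topologicalType) (act : G -> X -> X) : Prop :=
  forall U V : set X, open U -> open V -> U !=set0 -> V !=set0 ->
    exists g : G, U `&` (act g @` V) !=set0.

Definition minimal_action (G : topologicalGroupType) (X : topologicalType)
    (act : G -> X -> X) : Prop :=
  forall x : X, dense (range (fun g : G => act g x)).

(* The library's [equicontinuous] is the pointwise notion; this is the uniform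
   one (the two agree on compact spaces). *)
Definition equicontinuous_action (R : realType) (G : topologicalGroupType)
    (X : metricType R) (act : G -> X -> X) : Prop :=
  forall e : R, 0 < e -> exists2 delta : R, 0 < delta &
    forall (g : G) (x y : X), mdist x y < delta -> mdist (act g x) (act g y) < e.

Definition sensitive (R : realType) (G : topologicalGroupType)
    (X : metricType R) (act : G -> X -> X) : Prop :=
  exists2 e : R, 0 < e &
    forall (x : X) (U : set X), open U -> U x ->
      exists2 y : X, U y & exists g : G, e < mdist (act g x) (act g y).

(* X equipped with its Borel sigma-algebra *)
Notation borel X := (g_sigma_algebraType (@open X)).

Definition invariant_measure (R : realType) (G : topologicalGroupType)
    (X : pmetricType R) (act : G -> X -> X) (mu : probability (borel X) R) :
    Prop :=
  forall (g : G) (A : set (borel X)), measurable A ->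
    mu A = mu (act (g^-1)%g @` A).

Definition full_support (R : realType) (X : pmetricType R)
    (mu : probability (borel X) R) : Prop :=
  forall U : set X, open U -> U !=set0 -> (0 < mu U)%E.

(* Main.v *)
(** Suppose the action is not sensitive.  Then every [e > 0] admits a nonempty
    open set all of whose translates have diameter at most [e], and by
    transitivity there is such a set [U] inside any given nonempty open set
    [V].  All translates of [U] have the same positive measure, so finitely
    many translates [h_i U] meet every translate [g U].  Given [x], choose [g]
    such that [g U] comes close to [x], so close that [h_i^-1 g U] comes close
    to [h_i^-1 x] for every [i].  For the [i] such that [h_i U] meets [g U],
    the small set [h_i^-1 g U] meets [U], so that [h_i^-1 x] is close to [U],
    hence in [V].  The action is thus minimal.  Every orbit now enters an open
    set with small translates, so every point is an equicontinuity point, and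
    compactness makes this uniform. *)
Require Import Defs.
From HB Require Import structures.
From mathcomp Require Import all_boot all_order all_algebra.
From mathcomp Require Import all_classical all_reals all_analysis.
From mathcomp Require Import lra.

Set Implicit Arguments.
Unset Strict Implicit.

Import Order.TTheory GRing.Theory Num.Theory.

Local Open Scope classical_set_scope.
Local Open Scope ring_scope.

Lemma open_mdist_lt (R : realType) (X : metricType R) (x : X) (r : R) :
  open [set y | mdist x y < r].
Proof.
rewrite openE => y /= xyr; rewrite /interior -nbhs_ballE.
exists (r - mdist x y); rewrite /= ?subr_gt0// ballEmdist => z /= yz.
by have := metric_triangle x y z; lra.
Qed.

Lemma open_mdist_ball (R : realType) (X : metricType R) (U : set X) (x : X) :
  open U -> U x -> exists2 r : R, 0 < r & forall y, mdist x y < r -> U y.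
Proof.
rewrite openE => oU /oU; rewrite /interior -nbhs_ballE => -[r /= r0].
by rewrite ballEmdist => rU; exists r.
Qed.

Section Action.
Context {G : topologicalGroupType} {X : topologicalType} {act : G -> X -> X}.
Hypothesis actP : continuous_action act.

Lemma actK (g : G) : cancel (act g) (act g^-1%g).
Proof. by move=> x; rewrite -(act_mul actP) mulVg (act_one actP). Qed.

Lemma actVK (g : G) : cancel (act g^-1%g) (act g).
Proof. by move=> x; rewrite -(act_mul actP) mulgV (act_one actP). Qed.

Lemma continuous_act (g : G) : continuous (act g).
Proof.
move=> x; apply: (@continuous_comp _ _ _ (fun y => (g, y))
  (fun p : G * X => act p.1 p.2)); last exact: act_continuous.
by apply: cvg_pair; [exact: cvg_cst | exact: cvg_id].
Qed.

Lemma image_actE (g : G) (U : set X) : act g @` U = act g^-1%g @^-1` U.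
Proof.
apply/seteqP; split => [_ [x Ux <-]|x Ux] /=; first by rewrite actK.
by exists (act g^-1%g x) => //; rewrite actVK.
Qed.

Lemma open_image_act (g : G) (U : set X) : open U -> open (act g @` U).
Proof.
by rewrite image_actE; move: U; apply/continuousP; exact: continuous_act.
Qed.

End Action.

Section InvariantMeasure.
Context {R : realType} {G : topologicalGroupType} {X : pmetricType R}.
Context {act : G -> X -> X} {mu : probability (borel X) R}.
Hypothesis actP : continuous_action act.
Hypothesis mu_inv : invariant_measure act mu.

Lemma open_borel_measurable (U : set X) :
  open U -> measurable (U : set (borel X)).
Proof. by move=> oU; exact: sub_sigma_algebra. Qed.

Lemma measurable_translate (g : G) (U : set X) :
  open U -> measurable (act g @` U : set (borel X)).
Proof.
by move=> oU; apply: open_borel_measurable; exact: (open_image_act actP).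
Qed.

Lemma measure_translate (g : G) (U : set X) :
  open U -> mu (act g @` U) = mu U.
Proof.
move=> oU; rewrite (mu_inv g); last exact: measurable_translate.
by rewrite image_comp eq_image_id // => x _ /=; exact: actK.
Qed.

(** If no finite list works, each finite union of translates misses a further translate. Adding
    these one by one gives [n] disjoint translates of total measure [n] times [mu U], which
    eventually exceeds 1. *)
Lemma finitely_many_translates_meet_all (U : set X) :
  full_support mu -> open U -> U !=set0 ->
  exists s : seq G, forall g : G,
    exists2 h, h \in s & act g @` U `&` act h @` U !=set0.
Proof.
move=> mu_full oU U0; apply: contrapT => noseq.
have muU0 := mu_full U oU U0.
have mes (s : seq G) :
    measurable (\big[setU/set0]_(h <- s) (act h @` U) : set (borel X)).
  by apply: bigsetU_measurable => h _; exact: measurable_translate.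
have disj (s : seq G) : exists g : G,
    act g @` U `&` \big[setU/set0]_(h <- s) (act h @` U) = set0.
  apply: contrapT => nog; apply: noseq; exists s => g.
  apply: contrapT => noh; apply: nog; exists g.
  rewrite -bigcup_seq -subset0 => x [gx [h /= hs hx]]; apply: noh.
  by exists h => //; exists x.
have big_union n : exists s : seq G,
    mu (\big[setU/set0]_(h <- s) (act h @` U)) = (mu U *+ n)%E.
  elim: n => [|n [s mus]]; first by exists [::]; rewrite big_nil measure0.
  have [g gs0] := disj s; exists (g :: s); rewrite big_cons measureU //.
    by rewrite muleS; congr (_ + _)%E; [exact: measure_translate | exact: mus].
  exact: measurable_translate.
have muU_fin : mu U \is a fin_num.
  by apply: fin_num_measure; exact: open_borel_measurable.
have c0 : 0 < fine (mu U) by rewrite fine_gt0 // muU0 ltey_eq muU_fin.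
set c := fine (mu U) in c0.
(* This number of translates is larger than [c^-1], so their union would have measure above 1. *)
have [s mus] := big_union (Num.bound c^-1).
have := probability_le1 mu (mes s); rewrite mus -(fineK muU_fin) -/c.
rewrite -mule_natl -EFinM lee_fin -ler_pdivlMr // div1r leNgt => /negP; apply.
by rewrite archi_boundP // invr_ge0 ltW.
Qed.

End InvariantMeasure.

Section SmallOrbits.
Context {R : realType} {G : topologicalGroupType} {X : pmetricType R}.
Context {act : G -> X -> X}.
Hypothesis actP : continuous_action act.

Definition small_translates (e : R) (U : set X) : Prop :=
  forall (g : G) (y z : X), U y -> U z -> mdist (act g y) (act g z) <= e.

Lemma small_translates_image (e : R) (U : set X) (g : G) :
  small_translates e U -> small_translates e (act g @` U).
Proof.
move=> smU h _ _ [y Uy <-] [z Uz <-].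
by rewrite -!(act_mul actP); exact: smU.
Qed.

Lemma not_sensitive_small_translates (e : R) :
  ~ sensitive act -> 0 < e ->
  exists U : set X, [/\ open U, U !=set0 & small_translates e U].
Proof.
move=> nsens e0; apply: contrapT => noU; apply: nsens.
(* Where sensitivity fails with constant [e / 2], all translates of some neighborhood of [x] stay
   within [e / 2] of those of [x], hence have diameter at most [e]. *)
exists (e / 2); first by rewrite divr_gt0.
move=> x U oU Ux; apply: contrapT => noy; apply: noU.
exists U; split; [by [] | by exists x | move=> g y z Uy Uz].
have near_x w : U w -> mdist (act g x) (act g w) <= e / 2.
  by move=> Uw; rewrite leNgt; apply/negP => xw; apply: noy; exists w => //; exists g.
have := metric_triangle (act g y) (act g x) (act g z).
rewrite (metric_sym (act g y) (act g x)).
by have := near_x _ Uy; have := near_x _ Uz; lra.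
Qed.

Lemma small_translates_dense (e : R) (V : set X) :
  topologically_transitive act -> ~ sensitive act -> 0 < e ->
  open V -> V !=set0 ->
  exists U : set X, [/\ open U, U !=set0, U `<=` V & small_translates e U].
Proof.
move=> trans nsens e0 oV V0.
have [U [oU U0 smU]] := not_sensitive_small_translates nsens e0.
have [g VgU0] := trans V U oV oU V0 U0.
exists (V `&` act g @` U); split=> //; first by apply: openI => //; exact: (open_image_act actP).
by move=> h y z [_ gUy] [_ gUz]; exact: small_translates_image smU _ _ _ gUy gUz.
Qed.

Lemma nbhs_close_translates (s : seq G) (x : X) (r : R) : 0 < r ->
  \forall z \near x, forall h, h \in s -> mdist (act h x) (act h z) < r.
Proof.
move=> r0; elim: s => [|h s IH]; first by apply: nearW => z h.
have near_h : \forall z \near x, mdist (act h x) (act h z) < r.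
  have : nbhs (act h x) [set w | mdist (act h x) w < r].
    by apply: open_nbhs_nbhs; split; [exact: open_mdist_lt | rewrite /= mdistxx].
  by move/(@continuous_act _ _ _ actP h x).
near=> z => k; rewrite inE => /orP[/eqP ->|ks]; first by near: z.
by move: k ks; near: z.
Unshelve. all: by end_near. Qed.

Lemma not_sensitive_minimal (mu : probability (borel X) R) :
  invariant_measure act mu -> full_support mu ->
  topologically_transitive act -> ~ sensitive act -> minimal_action act.
Proof.
move=> mu_inv mu_full trans nsens x V [p Vp] oV.
have [r r0 rV] := open_mdist_ball oV Vp.
(* The path from [p] through [u2] and [act h^-1 z] to [act h^-1 x] has three steps of length at most
   [r / 4]. *)
have r40 : 0 < r / 4 by rewrite divr_gt0.
have [|U [oU U0 Up smU]] := small_translates_dense trans nsens r40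
    (open_mdist_lt p (r / 4)).
  by exists p; rewrite /= mdistxx.
have [s meets] := finitely_many_translates_meet_all actP mu_inv mu_full oU U0.
pose N : set X := [set z | forall h, h \in [seq k^-1%g | k <- s] ->
  mdist (act h x) (act h z) < r / 4].
have Nx : nbhs x N by exact: nbhs_close_translates.
have [|g [z [Nz [u Uu guz]]]] := trans N° U (@open_interior _ _) oU _ U0.
  by exists x.
have [h hs [w [[u1 Uu1 gu1] [u2 Uu2 hu2]]]] := meets g.
exists (act h^-1%g x); split; last by exists h^-1%g.
apply: rV; have /(_ h^-1%g) := nbhs_singleton Nz.
rewrite map_f // => /(_ isT) xz.
(* Since [g u = z] and [g u1 = h u2], the translate by [h^-1 g] sends [u] to [h^-1 z] and [u1] to
   [u2]. *)
have zw := smU (h^-1 * g)%g _ _ Uu Uu1.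
rewrite !(act_mul actP) guz gu1 -hu2 (actK actP) in zw.
have /= pu2 := Up _ Uu2.
have := metric_triangle p u2 (act h^-1%g x).
have := metric_triangle u2 (act h^-1%g z) (act h^-1%g x).
rewrite (metric_sym u2 (act h^-1%g z)).
rewrite (metric_sym (act h^-1%g z) (act h^-1%g x)).
by lra.
Qed.

Lemma minimal_not_sensitive_equicontinuous :
  compact [set: X] -> minimal_action act -> ~ sensitive act ->
  equicontinuous_action act.
Proof.
move=> cptX minX nsens e e0.
have e20 : 0 < e / 2 by rewrite divr_gt0.
have [U [oU U0 smU]] := not_sensitive_small_translates nsens e20.
pose P (d : R) (x : X) :=
  forall (g : G) (y : X), mdist x y < d -> mdist (act g x) (act g y) < e.
(* Compactness in its near-covering form: a bound on [d] valid around each point yields one valid on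
   all of [X]. *)
have near_P : \forall d \near 0^'+, [set: X] `<=` P d.
  have /compact_near_coveringP cov := cptX; apply: cov => x _.
  have [w [Uw [k _ kx]]] := minX x U U0 oU; rewrite -kx in Uw.
  have [r r0 rU] : exists2 r : R, 0 < r &
      forall y, mdist x y < r -> U (act k y).
    apply: (@open_mdist_ball _ _ (act k @^-1` U)) => //.
    by move/continuousP: (@continuous_act _ _ _ actP k); apply.
  (* One half is for the distance from [x] to [y], the other for that from [y] to [z], so that both
     [y] and [z] lie in the [r]-ball about [x]. *)
  have r20 : 0 < r / 2 by rewrite divr_gt0.
  exists ([set y | mdist x y < r / 2], [set d | d < r / 2]).
    split; last exact: nbhs_right_lt.
    apply: open_nbhs_nbhs; split; first exact: open_mdist_lt.
    by rewrite /= mdistxx.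
  move=> [y d] /= [xy dr] g z yz.
  have Uy : U (act k y) by apply: rU; lra.
  have Uz : U (act k z).
    by apply: rU; have := metric_triangle x y z; lra.
  (* The map [g] factors as [k], which brings both points into [U], followed by [g k^-1]. *)
  have := smU (g * k^-1)%g _ _ Uy Uz.
  by rewrite !(act_mul actP) !(actK actP); lra.
have [d [Pd d0]] : exists d, [set: X] `<=` P d /\ 0 < d.
  apply: (@filter_ex _ (0^'+ : set_system R)).
  by apply: filterI near_P _; exact: nbhs_right_gt.
by exists d => // g x y; exact: Pd.
Qed.

End SmallOrbits.

Theorem theorem1p8 (R : realType) (G : topologicalGroupType)
    (X : pmetricType R) (act : G -> X -> X)
    (cptX : compact [set: X])
    (actP : continuous_action act)
    (trans : topologically_transitive act)
    (inv_full : exists mu : probability (borel X) R,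
       invariant_measure act mu /\ full_support mu) :
  (minimal_action act /\ equicontinuous_action act) \/ sensitive act.
Proof.
have [sens|nsens] := pselect (sensitive act); first by right.
have [mu [mu_inv mu_full]] := inv_full.
have minX := not_sensitive_minimal actP mu_inv mu_full trans nsens.
by left; split=> //; exact: minimal_not_sensitive_equicontinuous.
Qed.
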